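(* Let $d\geq 2$ and let $\rho$ be a diagonal symmetric (DS) state acting on $\mathbb{C}^d\otimes\mathbb{C}^d$, with associated matrix $M(\rho)$. Then $\rho$ is separable if and only if $M(\rho)$ is completely positive.
   Context: Let $\{\ket{0},\dots,\ket{d-1}\}$ be the computational basis of $\mathbb{C}^d$. Define $\ket{D_{ii}}=\ket{ii}$ and, for $i<j$, $\ket{D_{ij}}=(\ket{ij}+\ket{ji})/\sqrt{2}$. A state $\rho$ on $\mathbb{C}^d\otimes\mathbb{C}^d$ is diagonal symmetric (DS) if $\rho=\sum_{0\le i\le j<d}p_{ij}\ket{D_{ij}}\bra{D_{ij}}$ with $p_{ij}\ge 0$ and $\sum_{i\le j}p_{ij}=1$; set $p_{ji}=p_{ij}$. Its associated matrix $M(\rho)$ is the real symmetric $d\times d$ matrix with entries $M(\rho)_{ii}=p_{ii}$ and $M(\rho)_{ij}=p_{ij}/2$ for $i\neq j$. A state is separable if it is a convex combination of product states $\rho^A\otimes\rho^B$. A real $d\times d$ matrix $A$ is completely positive if $A=BB^T$ for some real $d\times k$ matrix $B$ ($k\ge1$) with all entries $B_{ij}\ge 0$. *)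

(* Defs.v *)
From HB Require Import structures.
From mathcomp Require Import all_boot all_order all_algebra.
From mathcomp Require Import reals.
From mathcomp Require Import complex mxtens.
Set Implicit Arguments. Unset Strict Implicit. Unset Printing Implicit Defensive.
Import Order.TTheory GRing.Theory Num.Theory.
Local Open Scope ring_scope.
Local Open Scope complex_scope.

(* Complex numbers are R[i] for a real field R : realType.  Operators on
   C^n are n x n complex matrices; C^d (x) C^d is C^(d*d) with the
   Kronecker product [tensmx] (A *t B) of mathcomp-real-closed. *)

Definition adjmx (C : numClosedFieldType) m n (A : 'M[C]_(m, n)) : 'M[C]_(n, m) :=
  (map_mx Num.conj A)^T.

(* positive semidefinite: <v, A v> >= 0 for all v (in a numClosedField,
   0 <= z means z is real and nonnegative; this also forces A hermitian) *)
Definition psdmx (C : numClosedFieldType) n (A : 'M[C]_n) : Prop :=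
  forall v : 'cV[C]_n, 0 <= (adjmx v *m A *m v) 0 0.

Definition is_state (C : numClosedFieldType) n (A : 'M[C]_n) : Prop :=
  psdmx A /\ \tr A = 1.

Definition separable (C : numClosedFieldType) m n (rho : 'M[C]_(m * n)) : Prop :=
  exists (k : nat) (p : 'I_k -> C) (A : 'I_k -> 'M[C]_m) (B : 'I_k -> 'M[C]_n),
    [/\ forall i, 0 <= p i,
        \sum_i p i = 1,
        forall i, is_state (A i) /\ is_state (B i) &
        rho = \sum_i p i *: (A i *t B i)].

Definition ket (C : numClosedFieldType) d (i : 'I_d) : 'cV[C]_d := delta_mx i 0.
Definition ket2 (C : numClosedFieldType) d (i j : 'I_d) : 'cV[C]_(d * d) :=
  ket C i *t ket C j.

(* |D_ij><D_ij| : |D_ii> = |ii>, |D_ij> = (|ij> + |ji>)/sqrt 2 for i <> j *)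
Definition Dproj (C : numClosedFieldType) d (i j : 'I_d) : 'M[C]_(d * d) :=
  if i == j then ket2 C i i *m adjmx (ket2 C i i)
  else (2%:R^-1) *: ((ket2 C i j + ket2 C j i) *m adjmx (ket2 C i j + ket2 C j i)).

Definition DS_state (R : realType) d (p : 'I_d -> 'I_d -> R) : 'M[R[i]]_(d * d) :=
  \sum_(i < d) \sum_(j < d | (i <= j)%N) (p i j)%:C *: Dproj R[i] i j.

Definition assoc_mx (R : realType) d (p : 'I_d -> 'I_d -> R) : 'M[R]_d :=
  \matrix_(i, j) (if i == j then p i j else p i j / 2%:R).

Definition completely_positive (R : realType) d (A : 'M[R]_d) : Prop :=
  exists (k : nat) (B : 'M[R]_(d, k)),
    (0 < k)%N /\ (forall i j, 0 <= B i j) /\ A = B *m B^T.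

(* Main.v *)
Require Import Defs.
From HB Require Import structures.
From mathcomp Require Import all_boot all_order all_algebra.
From mathcomp Require Import ring.
From mathcomp Require Import reals.
From mathcomp Require Import complex mxtens.
Import Order.TTheory GRing.Theory Num.Theory.
Local Open Scope ring_scope.

(* If [rho = sum_t q_t A_t (x) B_t], the DS state kills every antisymmetric vector
   |ij> - |ji>, hence so does each term with [q_t <> 0].  By Cauchy-Schwarz on
   the 2 x 2 minors this forces [A_ii B_jj = A_jj B_ii] for all i, j, so [A_t]
   and [B_t] have the same diagonal [x_t] and [M(rho) = sum_t q_t x_t x_t^T].
   Conversely, if [M(rho) = sum_t b_t b_t^T], then [rho] is the sum over t of the
   averages of |v v><v v| over the vectors v with entries [sqrt (b_t i) * z_i],
   each [z_i] ranging over the fourth roots of unity: averaging kills the entry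
   at (ij, kl) unless {i, j} = {k, l} as multisets. *)

(** * Positive semidefinite matrices and the antisymmetric form *)

Section Psd.
Context {C : numClosedFieldType}.

Lemma rank_one_mxE n (v : 'cV[C]_n) i j :
  (v *m adjmx v) i j = v i 0 * (v j 0)^*.
Proof. by rewrite mxE big_ord1 !mxE. Qed.

Lemma psdmx_rank_one n (v : 'cV[C]_n) : psdmx (v *m adjmx v).
Proof.
move=> w; rewrite mulmxA -mulmxA mxE big_ord1.
suff -> : (adjmx v *m w) 0 0 = ((adjmx w *m v) 0 0)^* by apply: mul_conjC_ge0.
rewrite !mxE rmorph_sum; apply: eq_bigr => i _.
by rewrite !mxE rmorphM /= conjCK mulrC.
Qed.

Lemma psdmxZ n (c : C) (A : 'M[C]_n) : 0 <= c -> psdmx A -> psdmx (c *: A).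
Proof. by move=> c0 hA v; rewrite -scalemxAr -scalemxAl mxE mulr_ge0. Qed.

(** This is the form at [a e_i + b e_j]; suitable [a] and [b] yield the facts on diagonals,
    hermitian symmetry and minors below. *)
Lemma psdmx_form2 n (A : 'M[C]_n) i j (a b : C) : psdmx A ->
  0 <= a^* * a * A i i + a^* * b * A i j + b^* * a * A j i + b^* * b * A j j.
Proof.
move/(_ (a *: delta_mx i 0 + b *: delta_mx j 0)); congr (0 <= _).
have -> : adjmx (a *: delta_mx i 0 + b *: delta_mx j 0) =
    a^* *: delta_mx 0 i + b^* *: delta_mx 0 j :> 'rV[C]_n.
  apply/matrixP=> x y; rewrite !mxE rmorphD !rmorphM /= !ord1 eqxx !andbT.
  by rewrite !conjC_nat.
have form_delta k l : (delta_mx 0 k *m A *m delta_mx l 0 : 'M[C]_1) 0 0 = A k l.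
  by rewrite -rowE -colE !mxE.
rewrite !(mulmxDl, mulmxDr) -!(scalemxAl, scalemxAr).
have addE (X Y : 'M[C]_1) : (X + Y) 0 0 = X 0 0 + Y 0 0 by rewrite mxE.
have scaleE c (X : 'M[C]_1) : (c *: X) 0 0 = c * X 0 0 by rewrite mxE.
by rewrite !(addE, scaleE) !form_delta; ring.
Qed.

Lemma psdmx_diag_ge0 n (A : 'M[C]_n) i : psdmx A -> 0 <= A i i.
Proof.
by move/(psdmx_form2 _ _ i i 1 0); rewrite conjC0 conjC1 !(mul0r, mul1r, addr0).
Qed.

(** Polarization: the form is real at [e_i + e_j] and at [e_i + 'i e_j], and these two conditions
    determine [A j i] from [A i j]. *)
Lemma psdmx_hermitian n (A : 'M[C]_n) i j : psdmx A -> A j i = (A i j)^*.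
Proof.
move=> hA; have a0 := psdmx_diag_ge0 _ _ i hA.
have b0 := psdmx_diag_ge0 _ _ j hA.
have := ger0_real (psdmx_form2 _ _ i j 1 1 hA).
have := ger0_real (psdmx_form2 _ _ i j 1 'i hA).
move=> /CrealP + /CrealP.
rewrite !(rmorphD, rmorphM) /= !conjCK conjCi conjC1 (geC0_conj a0) (geC0_conj b0).
move: (A i j) (A j i) (A i i) (A j j) => x y a b E1 E2.
have {}E2 : x^* + y^* = x + y.
  apply: (addIr (a + b)).
  transitivity (1 * 1 * a + 1 * 1 * x^* + 1 * 1 * y^* + 1 * 1 * b); first by ring.
  by rewrite E2; ring.
have {}E1 : y^* - x^* = x - y.
  apply: (mulfI (neq0Ci C)).
  apply: (addIr (a - 'i * 'i * b)); move: E1.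
  set L := (X in X = _); set R := (X in _ = X) => E1.
  transitivity L; first by rewrite /L; ring.
  by rewrite E1 /R; ring.
have : 2%:R * (y - x^*) = 0.
  transitivity ((x + y) - (x - y) - 2%:R * x^*); first by ring.
  by rewrite -E1 -E2; ring.
by move/eqP; rewrite mulf_eq0 pnatr_eq0 /= subr_eq0 => /eqP.
Qed.

Lemma psdmx_minor2 n (A : 'M[C]_n) i j : psdmx A ->
  A i j * (A i j)^* <= A i i * A j j.
Proof.
move=> hA; have a0 := psdmx_diag_ge0 _ _ i hA.
have b0 := psdmx_diag_ge0 _ _ j hA.
(* The first two vectors give the minor times [A i i] and times [A j j]; the third serves when both
   diagonal entries vanish. *)
have := psdmx_form2 _ _ i j (A i j) (- A i i) hA.
have := psdmx_form2 _ _ i j (- A j j) ((A i j)^*) hA.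
have := psdmx_form2 _ _ i j (A i j) (-1) hA.
rewrite !rmorphN /= conjC1 conjCK (geC0_conj a0) (geC0_conj b0).
rewrite (psdmx_hermitian _ _ i j hA).
move: (A i j) (A i i) (A j j) a0 b0 => x a b a0 b0 E1 E2 E3.
rewrite -subr_ge0.
move: a0; rewrite le_eqVlt => /predU1P[a0|a0]; last first.
  rewrite -(pmulr_rge0 _ a0); move: E3; congr (0 <= _); ring.
move: b0; rewrite le_eqVlt => /predU1P[b0|b0]; last first.
  rewrite -(pmulr_rge0 _ b0); move: E2; congr (0 <= _); ring.
rewrite -(@pmulr_rge0 _ 2%:R) ?ltr0n //; move: E1; rewrite -a0 -b0.
congr (0 <= _); ring.
Qed.

Lemma psdmx_trace_ge0 n (A : 'M[C]_n) : psdmx A -> 0 <= \tr A.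
Proof. by move=> hA; apply: sumr_ge0 => i _; apply: psdmx_diag_ge0. Qed.

(** The nonnegative diagonal vanishes, and the 2 x 2 minors then kill the other entries. *)
Lemma psdmx_trace_eq0 n (A : 'M[C]_n) : psdmx A -> \tr A = 0 -> A = 0.
Proof.
move=> hA /eqP; rewrite psumr_eq0; last by move=> i _; apply: psdmx_diag_ge0.
move/allP => d0; apply/matrixP => i j; rewrite mxE; apply/eqP.
have := psdmx_minor2 _ _ i j hA.
rewrite (eqP (d0 i (mem_index_enum i))) mul0r => h.
by rewrite -mul_conjC_eq0 eq_le h mul_conjC_ge0.
Qed.

Lemma trace_tensmx m n (A : 'M[C]_m) (B : 'M[C]_n) : \tr (A *t B) = \tr A * \tr B.
Proof. by rewrite mulr_sum; apply: eq_bigr => i _; rewrite mxE. Qed.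

Lemma psdmx_normalize n (A : 'M[C]_n) : (0 < n)%N -> psdmx A ->
  exists2 S, is_state S & A = \tr A *: S.
Proof.
case: n A => // n A _ hA; have [t0|t0] := eqVneq (\tr A) 0.
  (* Here [A] is 0, so any state will do. *)
  pose v : 'cV[C]_n.+1 := delta_mx 0 0; exists (v *m adjmx v); last first.
    by rewrite t0 scale0r (psdmx_trace_eq0 _ _ hA t0).
  split; first exact: psdmx_rank_one.
  rewrite /mxtrace (bigD1 0) //= big1 => [|i i0]; rewrite !rank_one_mxE !mxE.
    by rewrite eqxx conjC1 mulr1 addr0.
  by rewrite (negPf i0) mul0r.
exists ((\tr A)^-1 *: A); last by rewrite scalerA mulfV ?scale1r.
split; last by rewrite mxtraceZ mulVf.
by apply: psdmxZ => //; rewrite invr_ge0 psdmx_trace_ge0.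
Qed.

(** The traces of the factors move into the weights, whose sum is then [\tr rho]. *)
Lemma separable_psd_sum (I : finType) m n (c : I -> C) (A : I -> 'M[C]_m)
    (B : I -> 'M[C]_n) (rho : 'M[C]_(m * n)) :
  (0 < m)%N -> (0 < n)%N -> (forall i, 0 <= c i) ->
  (forall i, psdmx (A i)) -> (forall i, psdmx (B i)) -> \tr rho = 1 ->
  rho = \sum_i c i *: (A i *t B i) -> separable rho.
Proof.
move=> m0 n0 c0 hA hB tr1 rhoE.
have /fin_all_exists2[S hS AE] i := psdmx_normalize _ _ m0 (hA i).
have /fin_all_exists2[T hT BE] i := psdmx_normalize _ _ n0 (hB i).
pose w i := c i * (\tr (A i) * \tr (B i)).
exists #|I|, (w \o enum_val), (S \o enum_val), (T \o enum_val); split.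
- by move=> i; rewrite /= /w !mulr_ge0 ?psdmx_trace_ge0.
- rewrite -(big_enum_val w) -tr1 rhoE raddf_sum; apply: eq_bigr => i _ /=.
  by rewrite mxtraceZ trace_tensmx.
- by move=> i /=.
rewrite /= -(big_enum_val (fun i => w i *: (S i *t T i))) rhoE.
apply: eq_bigr => i _; rewrite {1}AE {1}BE.
by apply/matrixP => x y; rewrite !mxE /w; ring.
Qed.

Lemma cross_term_bound (x y a a' b b' : C) :
  0 <= a -> 0 <= a' -> 0 <= b -> 0 <= b' ->
  x * x^* <= a * a' -> y * y^* <= b * b' ->
  (x * y^* + x^* * y) ^+ 2 <= 4%:R * (a * b') * (a' * b).
Proof.
move=> a0 a'0 b0 b'0 hx hy.
apply: (@le_trans _ _ (4%:R * ((x * x^*) * (y * y^*)))).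
  rewrite -subr_ge0.
  have := mul_conjC_ge0 (x * y^* - x^* * y).
  by rewrite rmorphB !rmorphM /= !conjCK; congr (0 <= _); ring.
rewrite -!mulrA ler_pM2l ?ltr0n // !mulrA.
apply: (@le_trans _ _ ((a * a') * (b * b'))); last first.
  by rewrite le_eqVlt; apply/orP; left; apply/eqP; ring.
by rewrite -mulrA ler_pM // mul_conjC_ge0.
Qed.

(* [<v, (A (x) B) v>] for the antisymmetric vector v = |ij> - |ji>. *)
Definition antisym_form m (A B : 'M[C]_m) i j :=
  A i i * B j j + A j j * B i i - (A i j * B j i + A j i * B i j).

(** The square of the off-diagonal part is at most [4 (a b') (a' b)], hence at most
    [(a b' + a' b)^2]. *)
Lemma antisym_form_ge0 m (A B : 'M[C]_m) i j : psdmx A -> psdmx B ->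
  0 <= antisym_form _ A B i j.
Proof.
move=> hA hB; rewrite /antisym_form.
have := psdmx_minor2 _ _ i j hA; have := psdmx_minor2 _ _ i j hB.
rewrite (psdmx_hermitian _ A i j hA) (psdmx_hermitian _ B i j hB) => hb ha.
have a0 := psdmx_diag_ge0 _ _ i hA; have a'0 := psdmx_diag_ge0 _ _ j hA.
have b0 := psdmx_diag_ge0 _ _ i hB; have b'0 := psdmx_diag_ge0 _ _ j hB.
have := cross_term_bound _ _ _ _ _ _ a0 a'0 b0 b'0 ha hb.
move: (A i i) (A j j) (B i i) (B j j) (A i j) (B i j) a0 a'0 b0 b'0 ha hb.
move=> a a' b b' x y a0 a'0 b0 b'0 ha hb hxy.
have zR : x * y^* + x^* * y \is Num.real.
  by apply/CrealP; rewrite rmorphD !rmorphM /= !conjCK addrC.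
rewrite subr_ge0; apply: (le_trans (real_ler_norm zR)).
rewrite -(ler_pXn2r (n := 2)) ?nnegrE ?addr_ge0 ?mulr_ge0 //.
rewrite real_normK //; apply: (le_trans hxy).
have : 0 <= (a * b' - a' * b) ^+ 2.
  by rewrite real_exprn_even_ge0 // rpredB ?ger0_real ?mulr_ge0.
by rewrite -[in X in _ -> X]subr_ge0; congr (0 <= _); ring.
Qed.

(** Equality case: the cross-term bound turns into [(a b' - a' b)^2 <= 0]. *)
Lemma antisym_form_eq0 m (A B : 'M[C]_m) i j : psdmx A -> psdmx B ->
  antisym_form _ A B i j = 0 -> A i i * B j j = A j j * B i i.
Proof.
move=> hA hB /eqP; rewrite /antisym_form subr_eq0 => /eqP.
have := psdmx_minor2 _ _ i j hA; have := psdmx_minor2 _ _ i j hB.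
rewrite (psdmx_hermitian _ A i j hA) (psdmx_hermitian _ B i j hB) => hb ha.
have a0 := psdmx_diag_ge0 _ _ i hA; have a'0 := psdmx_diag_ge0 _ _ j hA.
have b0 := psdmx_diag_ge0 _ _ i hB; have b'0 := psdmx_diag_ge0 _ _ j hB.
have := cross_term_bound _ _ _ _ _ _ a0 a'0 b0 b'0 ha hb.
move=> + E; rewrite -E => h.
apply/eqP; rewrite -subr_eq0 -sqrf_eq0 eq_le; apply/andP; split.
  by move: h; rewrite -subr_le0; congr (_ <= 0); ring.
by rewrite real_exprn_even_ge0 // rpredB ?ger0_real ?mulr_ge0.
Qed.

(** Sum [A i i * B j j = A j j * B i i] over [j] and use both unit traces. *)
Lemma state_diag_eq m (A B : 'M[C]_m) : is_state A -> is_state B ->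
  (forall i j, antisym_form _ A B i j = 0) -> forall i, A i i = B i i.
Proof.
move=> [hA tA] [hB tB] h0 i.
rewrite -[LHS]mulr1 -tB -[RHS]mul1r -tA /mxtrace mulr_sumr mulr_suml.
by apply: eq_bigr => j _; apply: antisym_form_eq0.
Qed.

End Psd.

(** * Averaging over fourth roots of unity *)

Definition same_pair {d} (i j k l : 'I_d) :=
  (i == k) && (j == l) || (i == l) && (j == k).

Section Phases.
Context {C : numClosedFieldType} {d : nat}.

(** Exponents in ['I_4] make the phase vectors a finite group, (Z/4)^d, whose addition multiplies
    phases. *)
Definition phase (f : {ffun 'I_d -> 'I_4}) i : C := 'i ^+ f i.

Lemma phase_conj f i : phase f i * (phase f i)^* = 1.
Proof.
by rewrite -normCK /phase normrX normCi !expr1n.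
Qed.

Lemma phaseD f g i : phase (f + g) i = phase f i * phase g i.
Proof.
rewrite /phase ffunE -exprD /= expr_mod //.
by rewrite (exprM _ 2 2) sqrCi sqrrN expr1n.
Qed.

(* Multiplying the phase of coordinate [a] by 'i permutes the phase vectors, so a
   monomial not fixed by some such kick sums to zero. *)
Definition kick (a : 'I_d) : {ffun 'I_d -> 'I_4} := [ffun i => (i == a)%:R].

Lemma phase_kick a i : phase (kick a) i = if i == a then 'i else 1.
Proof. by rewrite /phase ffunE; case: eqP => _; rewrite ?expr1 ?expr0. Qed.

(** The entry at (ij, kl) of |z z><z z| for the phase vector z. *)
Definition phase4 f i j k l := phase f i * phase f j * (phase f k * phase f l)^*.

Lemma phase4D f g i j k l :
  phase4 (f + g) i j k l = phase4 f i j k l * phase4 g i j k l.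
Proof. by rewrite /phase4 !phaseD !rmorphM /=; ring. Qed.

Lemma phase4_same f i j k l : same_pair i j k l -> phase4 f i j k l = 1.
Proof.
rewrite /phase4 rmorphM /=.
case/orP => /andP[/eqP-> /eqP->]; last rewrite (mulrC (phase f l)).
  by rewrite mulrACA !phase_conj mulr1.
by rewrite mulrACA !phase_conj mulr1.
Qed.

Lemma phase4_kick_neq1 i j k l : ~~ same_pair i j k l ->
  exists a, phase4 (kick a) i j k l != 1.
Proof.
have i1 : 'i != 1 :> C.
  by apply/eqP => /(congr1 (fun z => z ^+ 2)); rewrite sqrCi expr1n => /eqP;
     rewrite eqNr oner_eq0.
have N1 : -1 != 1 :> C by rewrite eqNr oner_eq0.
have rot (n m : bool) : n || m -> (if n then 'i else 1) * (if m then 'i else 1) != 1 :> C.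
  by case: n m => [] [] //= _; rewrite ?mulr1 ?mul1r // -expr2 sqrCi.
rewrite /same_pair /phase4 => h.
have [/orP ik|] := boolP ((i == k) || (i == l)); last first.
  rewrite negb_or => /andP[ik il]; exists i; rewrite !phase_kick eqxx.
  rewrite !(eq_sym _ i) (negPf ik) (negPf il) mulr1 conjC1 mulr1.
  exact: (rot true (i == j)).
(* The factor of [i] cancels against that of its match among [k] and [l], and [j] differs from the
   remaining index, so the value is exactly ['i]. *)
exists j; rewrite !phase_kick eqxx.
case: ik => /eqP E; move: h; rewrite -E eqxx /=; last rewrite orbC.
  rewrite negb_or => /andP[jl _]; rewrite (eq_sym l) (negPf jl).
  case: (i == j); rewrite !(mulr1, mul1r, conjC1) // conjCi.
  by rewrite mulrN -expr2 sqrCi mulN1r opprK.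
rewrite negb_or => /andP[jk _]; rewrite (eq_sym k) (negPf jk).
case: (i == j); rewrite !(mulr1, mul1r, conjC1) // conjCi.
by rewrite mulrN -expr2 sqrCi mulN1r opprK.
Qed.

(** As a function of [f], [phase4] is a character of (Z/4)^d, trivial exactly when the pairs
    agree. *)
Lemma sum_phase4 i j k l :
  \sum_f phase4 f i j k l = (same_pair i j k l)%:R * #|{ffun 'I_d -> 'I_4}|%:R.
Proof.
have [h|/phase4_kick_neq1[a ha]] := boolP (same_pair i j k l).
  rewrite mul1r (eq_bigr (fun => 1)) => [|f _]; last exact: phase4_same.
  by rewrite sumr_const.
rewrite mul0r; set S := LHS; have E : S = S * phase4 (kick a) i j k l.
  rewrite {1}/S (reindex_inj (addIr (kick a))) /= mulr_suml.
  by apply: eq_bigr => f _; rewrite phase4D.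
apply/eqP; move/eqP: E; rewrite -{1}[S]mulr1 -subr_eq0 -mulrBr mulf_eq0.
by rewrite subr_eq0 (eq_sym 1) (negPf ha) orbF.
Qed.
End Phases.

(** * Entries and trace of diagonal symmetric states *)

Section DiagonalSymmetric.
Context {R : realType} {d : nat}.
Implicit Type p : 'I_d -> 'I_d -> R.

Lemma ket2_delta (C : numClosedFieldType) (a b : 'I_d) :
  ket2 C a b = delta_mx (mxtens_index (a, b)) 0.
Proof.
apply/matrixP => x y; case: (mxtens_indexP x) => i j.
rewrite !mxE mxtens_indexK /= !ord1 !eqxx !andbT -natrM mulnb.
by rewrite (can_eq (@mxtens_indexK d d)).
Qed.

Lemma ket2E (C : numClosedFieldType) (a b i j : 'I_d) (x : 'I_1) :
  ket2 C a b (mxtens_index (i, j)) x = ((i == a) && (j == b))%:R.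
Proof. by rewrite ket2_delta mxE ord1 eqxx andbT (can_eq (@mxtens_indexK d d)). Qed.

Lemma trace_ket2 (C : numClosedFieldType) (a b a' b' : 'I_d) :
  \tr (ket2 C a b *m adjmx (ket2 C a' b')) = ((a == a') && (b == b'))%:R.
Proof.
rewrite mxtrace_mulC !ket2_delta /adjmx map_delta_mx trmx_delta.
rewrite mul_delta_mx_cond trace_mx11 mulmxnE mxE !eqxx.
by rewrite (can_eq (@mxtens_indexK d d)) eq_sym xpair_eqE.
Qed.

Lemma DprojE (C : numClosedFieldType) (a b i j k l : 'I_d) :
  Dproj C a b (mxtens_index (i, j)) (mxtens_index (k, l)) =
  (same_pair i j a b && same_pair k l a b)%:R * (if a == b then 1 else 2%:R^-1).
Proof.
rewrite /Dproj /same_pair; have [->|ab] := eqVneq a b.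
  by rewrite rank_one_mxE !ket2E conjC_nat !orbb mulr1 -natrM mulnb.
have addE (v w : 'cV[C]_(d * d)) x : (v + w) x 0 = v x 0 + w x 0 by rewrite mxE.
rewrite mxE rank_one_mxE !addE !ket2E rmorphD /= !conjC_nat mulrC; congr (_ * _).
(* For [a != b] the two indicators exclude each other, so their sum is again an indicator. *)
have disj (x y : 'I_d) : (x == a) && (y == b) -> (x == b) && (y == a) = false.
  by case/andP => /eqP-> _; rewrite (negPf ab).
have orE (x y : 'I_d) : ((x == a) && (y == b))%:R + ((x == b) && (y == a))%:R =
    ((x == a) && (y == b) || (x == b) && (y == a))%:R :> C.
  by case: (_ && _) (disj x y) => [/(_ isT)->|_]; rewrite ?addr0 ?add0r.
by rewrite !orE -natrM mulnb.
Qed.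

Lemma DS_stateE p i j k l : (forall i j, p j i = p i j) ->
  DS_state p (mxtens_index (i, j)) (mxtens_index (k, l)) =
  if same_pair i j k l then (assoc_mx p i j)%:C%C else 0.
Proof.
move=> psym; rewrite /DS_state summxE.
under eq_bigr do rewrite summxE.
rewrite pair_big_dep /=.
under eq_bigr do rewrite mxE DprojE.
(* The sum runs over pairs [a <= b]; once [i <= j], only the term [(i, j)] can contribute to this
   entry. *)
wlog ij : i j / (i <= j)%N.
  move=> wl; have [/wl//|/ltnW/wl] := leqP i j.
  have swap (x y : 'I_d) : same_pair j i x y = same_pair i j x y.
    by rewrite /same_pair orbC andbC [in X in _ || X]andbC.
  rewrite swap; under eq_bigr do rewrite swap.
  move=> ->; congr (if _ then _%:C%C else _).
  by rewrite !mxE (eq_sym j) psym.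
rewrite (bigD1 (i, j)) //= big1 ?addr0 => [|[a b] /= /andP[ab ne]]; last first.
  have -> : same_pair i j a b = false; last by rewrite mul0r mulr0.
  apply: contraNF ne; rewrite /same_pair xpair_eqE.
  case/orP => /andP[/eqP ia /eqP jb]; rewrite ia jb ?eqxx //.
  have /eqP/val_inj-> : (a == b :> nat)%N by rewrite eqn_leq ab -ia -jb ij.
  by rewrite eqxx.
have -> : same_pair i j i j by rewrite /same_pair !eqxx.
have -> : same_pair k l i j = same_pair i j k l.
  by rewrite /same_pair !(eq_sym k) !(eq_sym l) (andbC (i == l)).
rewrite /= mulrCA mxE; case: (same_pair i j k l); last by rewrite mul0r.
rewrite mul1r; case: eqP => _; first by rewrite mulr1.
by rewrite rmorphM fmorphV rmorph_nat.
Qed.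

Lemma trace_Dproj (C : numClosedFieldType) (a b : 'I_d) : \tr (Dproj C a b) = 1.
Proof.
rewrite /Dproj; have [->|ab] := eqVneq a b; first by rewrite trace_ket2 !eqxx.
have adjD (v w : 'cV[C]_(d * d)) : adjmx (v + w) = adjmx v + adjmx w.
  by apply/matrixP => x y; rewrite !mxE rmorphD.
rewrite mxtraceZ adjD mulmxDl !mulmxDr !raddfD /= !trace_ket2 !eqxx.
by rewrite (eq_sym b) (negPf ab) /= addr0 add0r -natrD mulVf ?pnatr_eq0.
Qed.

Lemma trace_DS_state p : (forall i j, p j i = p i j) ->
  \sum_(i < d) \sum_(j < d | (i <= j)%N) p i j = 1 -> \tr (DS_state p) = 1.
Proof.
move=> psym p1; rewrite -(rmorph1 (real_complex R)) -p1 rmorph_sum raddf_sum.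
apply: eq_bigr => i _; rewrite rmorph_sum raddf_sum; apply: eq_bigr => j _.
rewrite /= mxtraceZ -[RHS]mulr1; congr (_ * _).
exact: trace_Dproj.
Qed.

(** * The two implications *)

Lemma completely_positive_assoc_mx p : (forall i j, p j i = p i j) ->
  separable (DS_state p) -> completely_positive (assoc_mx p).
Proof.
move=> psym [n [q [A [B [q0 q1 hAB rhoE]]]]].
have entry i j k l : (if same_pair i j k l then (assoc_mx p i j)%:C%C else 0) =
    \sum_t q t * (A t i k * B t j l).
  rewrite -DS_stateE // rhoE summxE; apply: eq_bigr => t _.
  by rewrite mxE tensmxE.
have antisym0 t i j : q t != 0 -> antisym_form _ (A t) (B t) i j = 0.
  move=> qt; have nn s : 0 <= q s * antisym_form _ (A s) (B s) i j.
    by have [[? _] [? _]] := hAB s; rewrite mulr_ge0 ?antisym_form_ge0.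
  (* The four sums are the entries of the state at (ij, ij), (ji, ji), (ij, ji) and (ji, ij), which
     cancel. *)
  have : \sum_s q s * antisym_form _ (A s) (B s) i j = 0.
    transitivity (\sum_s (q s * (A s i i * B s j j) + q s * (A s j j * B s i i)
      - (q s * (A s i j * B s j i) + q s * (A s j i * B s i j)))).
      by apply: eq_bigr => s _; rewrite /antisym_form; ring.
    rewrite !(big_split, sumrN) /= -!entry /same_pair !eqxx /= !orbT.
    by rewrite subrr.
  move/eqP; rewrite psumr_eq0 => [/allP/(_ t (mem_index_enum t))|s _] //.
  by rewrite /= mulf_eq0 (negPf qt) => /eqP.
(* Column [t] is [sqrt (q t)] times the diagonal of [A t]. *)
exists n, (\matrix_(i, t) (Num.sqrt (complex.Re (q t)) * complex.Re (A t i i))).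
have q0R t : 0 <= complex.Re (q t) by rewrite -lecR RRe_real // ger0_real.
have A0 t i : 0 <= A t i i by have [[? _] _] := hAB t; apply: psdmx_diag_ge0.
split; last split.
- case: n q q1 {A B q0 hAB rhoE entry antisym0 q0R A0} => // q.
  by rewrite big_ord0 => /eqP; rewrite eq_sym oner_eq0.
- by move=> i t; rewrite mxE mulr_ge0 ?sqrtr_ge0 // -lecR RRe_real // ger0_real.
apply/matrixP => i j; apply: (@complexI R).
have := entry i j i j; rewrite /same_pair !eqxx /= => ->.
rewrite mxE rmorph_sum; apply: eq_bigr => t _ /=.
rewrite !mxE mulrACA -expr2 sqr_sqrtr // !rmorphM /= !RRe_real ?ger0_real //.
(* The diagonals of [A t] and [B t] are known to agree only for nonzero weight; the other terms
   vanish. *)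
have [->|qt] := eqVneq (q t) 0; first by rewrite !mul0r.
have [sA sB] := hAB t.
by rewrite (state_diag_eq _ _ _ sA sB (fun x y => antisym0 t x y qt) j).
Qed.

Lemma separable_DS_state p : (0 < d)%N -> (forall i j, p j i = p i j) ->
  \sum_(i < d) \sum_(j < d | (i <= j)%N) p i j = 1 ->
  completely_positive (assoc_mx p) -> separable (DS_state p).
Proof.
move=> d0 psym p1 [n [B [_ [B0 ME]]]].
(* Each coordinate enters |v v><v v| once in the ket and once in the bra, so square roots give
   [B i t * B j t] at (ij, ij). *)
pose v (t : 'I_n * {ffun 'I_d -> 'I_4}) : 'cV[R[i]]_d :=
  \col_i ((Num.sqrt (B i t.1))%:C%C * phase t.2 i).
pose c : R[i] := #|{ffun 'I_d -> 'I_4}|%:R^-1.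
apply: (@separable_psd_sum _ _ _ _ (fun=> c) (fun t => v t *m adjmx (v t))
  (fun t => v t *m adjmx (v t))) => //.
- by move=> _; rewrite invr_ge0 ler0n.
- by move=> t; apply: psdmx_rank_one.
- by move=> t; apply: psdmx_rank_one.
- exact: trace_DS_state.
apply/matrixP => x y; case: (mxtens_indexP x) => i j; case: (mxtens_indexP y) => k l.
rewrite DS_stateE // summxE.
pose s i t : R[i] := (Num.sqrt (B i t))%:C%C.
(* Summing over [f] first leaves [4 ^ d] on matching pairs, which [c] cancels, and 0 elsewhere. *)
transitivity (\sum_t \sum_f c * (s i t * s j t * (s k t * s l t)) * phase4 f i j k l).
  under eq_bigr do rewrite -mulr_sumr sum_phase4.
  case: ifP => [h|_]; last by rewrite big1 // => t _; rewrite mul0r mulr0.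
  rewrite ME mxE rmorph_sum; apply: eq_bigr => t _ /=.
  have -> : s k t * s l t = s i t * s j t.
    by case/orP: h => /andP[/eqP-> /eqP->] //; rewrite mulrC.
  rewrite mul1r mulrAC mulVf ?mul1r.
    by rewrite mulrACA /s -!rmorphM /= -!expr2 !sqr_sqrtr // mxE.
  by rewrite pnatr_eq0 card_ffun !card_ord expn_eq0.
rewrite pair_bigA /=; apply: eq_bigr => -[t f] _ /=.
have sJ x' : (s x' t)^* = s x' t by rewrite geC0_conj // ler0c sqrtr_ge0.
rewrite mxE tensmxE !rank_one_mxE !mxE !rmorphM /= -!/(s _ _) !sJ /phase4 rmorphM /=.
ring.
Qed.

End DiagonalSymmetric.

(* p : the coefficients p_ij of the DS state, with p_ji = p_ij. *)
Theorem theorem1 (R : realType) (d : nat) (p : 'I_d -> 'I_d -> R) :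
  (2 <= d)%N ->
  (forall i j, p j i = p i j) ->
  (forall i j, 0 <= p i j) ->
  \sum_(i < d) \sum_(j < d | (i <= j)%N) p i j = 1 ->
  separable (DS_state p) <-> completely_positive (assoc_mx p).
Proof.
move=> d2 psym _ p1; split; first exact: completely_positive_assoc_mx.
by apply: separable_DS_state => //; apply: leq_trans d2.
Qed.
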